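(* Let $H$ be a finite set of unit vectors in $\mathbb{R}^d$ not contained in any closed half of the unit sphere, and let $k=|H|$. Let $S$ be a finite set in $\mathbb{R}^d$ and let $M$ be a matroid complex with rank function $\rho$ and vertex set $V$. For each $v\in V$ let $K_v$ be an $H$-convex set in $\mathbb{R}^d$. Suppose that for each independent set $U\subset V$ there is a point of $S$ in $\bigcap_{v\in U}K_v$. Then there exists a set $T\subset V$ such that $\rho(V\setminus T)\le k-1$ and there is a point of $S$ in $\bigcap_{v\in T}K_v$.
   Context: For a set $H\subseteq S^{d-1}$ of unit vectors not contained in any closed half-sphere, a set in $\mathbb{R}^d$ is $H$-convex if it can be written as an intersection of halfspaces of the form $\{x\in\mathbb{R}^d:\langle x,h\rangle\le c\}$ with $h\in H$ and $c\in\mathbb{R}$. A matroid complex on vertex set $V$ is the simplicial complex whose faces are the independent sets of a matroid on $V$; $\rho$ is the rank function of that matroid. *)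

(* Defs.v *)
From mathcomp Require Import all_boot all_order all_algebra finmap.
From mathcomp Require Import all_classical all_reals.

Set Implicit Arguments.
Unset Strict Implicit.
Unset Printing Implicit Defensive.

Import Order.TTheory GRing.Theory Num.Theory.
Local Open Scope classical_set_scope.
Local Open Scope ring_scope.

Definition dotv (R : realType) (d : nat) (x y : 'rV[R]_d) : R :=
  \sum_(i < d) x 0 i * y 0 i.

(* The library norm `|x| on row vectors is the sup norm, hence a separate
   definition of the Euclidean norm. *)
Definition enorm (R : realType) (d : nat) (x : 'rV[R]_d) : R :=
  Num.sqrt (dotv x x).

Definition usphere (R : realType) (d : nat) : set 'rV[R]_d :=
  [set x | enorm x = 1].
Arguments usphere : clear implicits.

Definition closed_half_sphere (R : realType) (d : nat) (u : 'rV[R]_d) :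
    set 'rV[R]_d :=
  usphere R d `&` [set x | 0 <= dotv x u].

Definition halfspace (R : realType) (d : nat) (h : 'rV[R]_d) (c : R) :
    set 'rV[R]_d :=
  [set x | dotv x h <= c].

(* F is an arbitrary (possibly infinite or empty) family of pairs (h, c); the
   empty family yields the whole space. *)
Definition Hconvex (R : realType) (d : nat) (H K : set 'rV[R]_d) : Prop :=
  exists F : set ('rV[R]_d * R),
    (forall p, F p -> H p.1) /\ K = \bigcap_(p in F) halfspace p.1 p.2.

(* A matroid on V; the set indep is the face set of its matroid complex.
   Loops are allowed. *)
Record matroid (V : finType) := Matroid {
  indep : {set {set V}};
  indep_set0 : finset.set0 \in indep;
  indep_subset : forall A B : {set V},
    A \subset B -> B \in indep -> A \in indep;
  indep_augment : forall A B : {set V},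
    A \in indep -> B \in indep -> (#|A| < #|B|)%N ->
    exists2 x, x \in B :\: A & x |: A \in indep
}.

Definition mrank (V : finType) (M : matroid V) (A : {set V}) : nat :=
  \max_(U in indep M | U \subset A) #|U|.

(* Main.v *)
(** Order the points of [S] by the first direction [h1] of [H], breaking ties
    arbitrarily, and for an independent set [U] let [x_U] be the first point of
    [S] in the intersection of the [K_v], [v] in [U].  Among the independent
    sets with at most [k - 1] elements choose [U] with [x_U] last, and let [T]
    be the set of all [v] such that [K_v] contains [x_U].  If [v] lies outside
    [T] and [U + v] is independent, then [x_(U+v)] comes strictly after [x_U].
    Every point before [x_(U+v)] violates, within [U + v], a constraint in a
    direction other than [h1], and for each of these [k - 1] directions a single
    member of [U + v] is the most restrictive; these members form an independent
    set [W] with [x_W = x_(U+v)], against the choice of [U].  Hence [U] spans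
    the complement of [T]. *)
Require Import Defs.
From mathcomp Require Import all_boot all_order all_algebra finmap.
From mathcomp Require Import all_classical all_reals.

Set Implicit Arguments.
Unset Strict Implicit.
Unset Printing Implicit Defensive.

Import Order.TTheory GRing.Theory Num.Theory.
Local Open Scope classical_set_scope.
Local Open Scope ring_scope.

(** Positions in a list sorted by [f] serve as [r]. *)
Lemma finType_linearization (X : finType) (disp : Order.disp_t)
    (L : orderType disp) (f : X -> L) :
  exists2 r : X -> nat, injective r &
    forall x y, (r x <= r y)%N -> (f x <= f y)%O.
Proof.
pose e (x y : X) := (f x <= f y)%O.
have e_tr : transitive e by move=> y x z; apply: le_trans.
have e_total : total e by move=> x y; apply: le_total.
have mem_s x : x \in sort e (enum X) by rewrite mem_sort mem_enum.
exists (index^~ (sort e (enum X))) => [x y|x y].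
  by apply: index_inj.
apply: (sorted_leq_index e_tr) => //; first by move=> z; apply: lexx.
exact: sort_sorted.
Qed.

(** For fixed [i] the sets [P v i] are initial segments for [f i], hence nested. A member of [U]
    that fails at the [f i]-least point where any member fails is the most restrictive; [W] collects
    one such member for each [i]. *)
Lemma lower_family_witness (V X : finType) (I : eqType) (disp : Order.disp_t)
    (L : orderType disp) (f : I -> X -> L) (P : V -> I -> pred X)
    (P_lower : forall v i x y, (f i x <= f i y)%O -> P v i y -> P v i x)
    (U : {set V}) (s : seq I) :
  exists W : {set V}, [/\ W \subset U, (#|W| <= size s)%N &
    forall x i, i \in s -> (forall w, w \in W -> P w i x) ->
      forall v, v \in U -> P v i x].
Proof.
elim: s => [|i s [W [WU Ws WP]]].
  by exists finset.set0; split; rewrite ?finset.sub0set ?cards0 // => x i; rewrite in_nil.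
pose bad x := [exists v in U, ~~ P v i x].
have [x0 bad_x0|no_bad] := pickP bad; last first.
  exists W; split=> //; first exact: leqW.
  move=> x j; rewrite inE => /predU1P[-> _ v vU|js /WP]; last exact.
  by apply: contraFT (no_bad x) => nP; apply/existsP; exists v; rewrite vU.
case: (Order.TotalTheory.arg_minP (f i) bad_x0) => y /existsP[u /andP[uU nPu]] y_min.
exists (u |: W)%SET; split.
- by rewrite finset.subUset finset.sub1set uU.
- by rewrite (leq_trans (leq_card_setU _ _)) // cards1.
move=> x j; rewrite inE => /predU1P[-> PW v vU|js PW]; last first.
  by apply: WP => // w wW; apply: PW; rewrite in_setU1 wW orbT.
apply: contraNT nPu => nPv; apply: (P_lower _ _ _ x).
  by apply: y_min; apply/existsP; exists v; rewrite vU.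
by apply: PW; rewrite setU11.
Qed.

(** A larger independent subset of [A] would augment [U] by an element of [A]. *)
Lemma mrank_le_span (V : finType) (M : matroid V) (U A : {set V}) :
  U \in indep M ->
  (forall v, v \in A -> v \notin U -> (v |: U)%SET \notin indep M) ->
  (mrank M A <= #|U|)%N.
Proof.
move=> Ui A_span; apply/bigmax_leqP => B /andP[Bi BA].
rewrite leqNgt; apply/negP => /(indep_augment Ui Bi)[v].
rewrite finset.in_setD => /andP[vU vB]; apply/negP.
by apply: A_span => //; apply: (fintype.subsetP BA).
Qed.

(** The combinatorial core: geometry enters only through [P_lower], the monotonicity of each
    constraint in its direction. *)
Lemma matroid_lower_family (V X : finType) (M : matroid V) (I : eqType)
    (disp : Order.disp_t) (L : orderType disp) (f : I -> X -> L)
    (P : V -> I -> pred X)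
    (P_lower : forall v i x y, (f i x <= f i y)%O -> P v i y -> P v i x)
    (s : seq I)
    (P_indep : forall U : {set V}, U \in indep M ->
       exists x, forall v, v \in U -> forall i, i \in s -> P v i x) :
  exists T : {set V}, (mrank M (~: T)%SET <= size s - 1)%N /\
    exists x, forall v, v \in T -> forall i, i \in s -> P v i x.
Proof.
case: s P_indep => [|i0 s] P_indep.
  (* Without directions the truncated bound is 0, and any point satisfies all constraints
     vacuously. *)
  have [x _] := P_indep _ (indep_set0 M).
  exists finset.setT; split; last by exists x.
  apply: leq_trans (mrank_le_span (indep_set0 M) _) _; last by rewrite cards0.
  by move=> v; rewrite finset.setCT finset.in_set0.
have [r r_inj r_le] := finType_linearization (f i0).
pose Q (U : {set V}) x := [forall v in U, all (fun i => P v i x) (i0 :: s)].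
have QP (U : {set V}) x : reflect (forall v, v \in U -> forall i, i \in i0 :: s -> P v i x)
                      (Q U x).
  apply: (iffP forall_inP) => PU v vU; last by apply/allP/PU.
  by move=> i si; exact: (allP (PU v vU) i si).
pose first (U : {set V}) x := Q U x && [forall y, Q U y ==> (r x <= r y)%N].
have firstP (U : {set V}) : U \in indep M -> exists x, first U x.
  move=> /P_indep[x0 /QP Qx0]; case: (arg_minnP r Qx0) => x Qx x_min.
  by exists x; rewrite /first Qx; apply/forallP => y; apply/implyP/x_min.
(* Here [size s] is the number of directions other than [i0]. *)
pose small (p : {set V} * X) :=
  [&& p.1 \in indep M, (#|p.1| <= size s)%N & first p.1 p.2].
have [x0 first_x0] := firstP _ (indep_set0 M).
have small0 : small (finset.set0, x0) by rewrite /small indep_set0 cards0.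
case: (arg_maxnP (fun p => r p.2) small0) => -[U x] /and3P[/= Ui Us first_x] x_max.
have /andP[/QP PUx /forallP x_first] := first_x.
exists [set v | all (fun i => P v i x) (i0 :: s)]%SET; split; last first.
  by exists x => v; rewrite inE => /allP.
rewrite subn1 /=; apply: leq_trans Us; apply: mrank_le_span => // v.
rewrite finset.in_setC inE => nPvx _; apply/negP => vUi.
have [y /andP[/QP PUy /forallP y_first]] := firstP _ vUi.
have lt_xy : (r x < r y)%N.
  rewrite ltn_neqAle; apply/andP; split.
    apply: contra nPvx => /eqP/r_inj ->.
    by apply/(@allP _ _ (i0 :: s)) => i; apply: PUy; rewrite setU11.
  apply: (implyP (x_first y)); apply/QP => u uU.
  by apply: PUy; rewrite in_setU1 uU orbT.
have [W [WU Ws PW]] := lower_family_witness P_lower (v |: U)%SET s.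
have Wi := indep_subset WU vUi.
have [z first_z] := firstP _ Wi.
have le_zx : (r z <= r x)%N.
  by apply: (x_max (W, z)); rewrite /small /= Wi Ws.
have lt_zy := leq_ltn_trans le_zx lt_xy.
suff /(implyP (y_first z)) : Q (v |: U)%SET z by rewrite leqNgt lt_zy.
have /andP[/QP PWz _] := first_z.
(* In direction [i0], [z] inherits the constraints from the later point [y]; in the others, [W]
   decides. *)
apply/QP => u uU i; rewrite inE => /predU1P[->|si].
  apply: P_lower (r_le _ _ (ltnW lt_zy)) _.
  by apply: PUy => //; rewrite mem_head.
by apply: PW uU => // w wW; apply: PWz => //; rewrite inE si orbT.
Qed.

Theorem theorem5p4 (R : realType) (d : nat) (H : {fset 'rV[R]_d})
    (H_unit : [set` H] `<=` usphere R d)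
    (H_not_half : forall u : 'rV[R]_d, usphere R d u ->
       ~ ([set` H] `<=` closed_half_sphere u))
    (k : nat) (k_def : k = #|` H|%fset)
    (S : {fset 'rV[R]_d})
    (V : finType) (M : matroid V)
    (K : V -> set 'rV[R]_d)
    (K_convex : forall v : V, Hconvex [set` H] (K v))
    (K_indep : forall U : {set V}, U \in indep M ->
       exists2 x, x \in S & (\bigcap_(v in [set` U]) K v) x) :
  exists T : {set V},
    (mrank M (~: T)%SET <= k - 1)%N /\
    exists2 x, x \in S & (\bigcap_(v in [set` T]) K v) x.
Proof.
have [F F_K] := choice K_convex.
pose f (h : 'rV[R]_d) (x : S) : R := dotv (val x) h.
(* All halfspaces of [K v] with normal [h], possibly none or infinitely many, merge into one
   constraint. *)
pose P v h (x : S) := `[< forall c, F v (h, c) -> f h x <= c >].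
have P_lower v h x y : f h x <= f h y -> P v h y -> P v h x.
  by move=> le_xy /asboolP Py; apply/asboolP => c /Py; apply: le_trans.
have PK v (x : S) : (forall h, h \in enum_fset H -> P v h x) <-> K v (val x).
  have [FH ->] := F_K v; split=> [Px [h c] Fhc|Kx h _].
    by have /asboolP/(_ c Fhc) := Px h (FH _ Fhc).
  by apply/asboolP => c /Kx.
have [|T [rkT [x PTx]]] := @matroid_lower_family V S M _ _ R f P P_lower H.
  move=> U /K_indep[x xS Kx]; exists [` xS]%fset => v vU.
  by apply/PK; apply: Kx.
exists T; split; first by rewrite k_def.
by exists (val x) => [|v vT]; [exact: valP | apply/PK/PTx].
Qed.
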